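(* Let $f:\mathbb{R}^n\to\mathbb{R}$, $f(x)=\frac1m\sum_{i=1}^m f_i(x)$, where each $f_i:\mathbb{R}^n\to\mathbb{R}$ is differentiable and (possibly non-convex) $L$-smooth with $L>0$, i.e. $\|\nabla f_i(x)-\nabla f_i(y)\|_2\le L\|x-y\|_2$ for all $x,y\in\mathbb{R}^n$. Suppose $f(x)\ge f_*$ for all $x\in\mathbb{R}^n$, where $f_*\in\mathbb{R}$, and let $\sigma^2\in[0,+\infty]$ be such that for $\xi$ uniform on $\{1,\ldots,m\}$ and all $x\in\mathbb{R}^n$, $$\mathbb{E}_\xi\big[\|\nabla f_\xi(x)-\nabla f(x)\|_2^2\big]\le\sigma^2 .$$ Let $\varepsilon>0$, $x^0\in\mathbb{R}^n$, and set $$r=\max\Big\{1,\frac{20\sigma^2}{\varepsilon^2}\Big\},\qquad q=\min\{r,m\},\qquad h=\frac{1}{10L\sqrt q}.$$ Consider the iterates $x^{k+1}=x^k-hg^k$, $k\ge0$, where $$g^k=\begin{cases}\frac1r\sum_{j=1}^r\nabla f_{\xi_{k,j}}(x^k), & \text{if } r<m \text{ and } r \text{ divides } k,\\ \nabla f(x^k), & \text{if } m\le r \text{ and } m \text{ divides } k,\\ \nabla f_{\xi_k}(x^k)-\nabla f_{\xi_k}(x^{k-1})+g^{k-1}, & \text{otherwise,}\end{cases}$$ and all the indices $\xi_k$ and $\xi_{k,1},\ldots,\xi_{k,r}$ that are used are independent and uniformly distributed on $\{1,\ldots,m\}$. For an integer $\hat N\ge0$, let $\hat x^{\hat N}$ be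 chosen uniformly at random from $x^0,\ldots,x^{\hat N}$, independently of everything else. Then for every integer $\hat N\ge0$, $$\mathbb{E}\big[\|\nabla f(\hat x^{\hat N})\|_2^2\big]\le\frac{2000L\sqrt q\,(f(x^0)-f_* )}{23(\hat N+1)}+\frac{33\varepsilon^2}{46}.$$ Consequently, after $$\hat N=\frac{4000L\sqrt q\,(f(x^0)-f_* )}{13\varepsilon^2}=\frac{4000L(f(x^0)-f_* )}{13\varepsilon^2}\min\left\{\sqrt m,\max\left\{1,\frac{\sqrt{20}\,\sigma}{\varepsilon}\right\}\right\}$$ iterations one has $\mathbb{E}[\|\nabla f(\hat x^{\hat N})\|_2^2]\le\varepsilon^2$, and this requires $$O\left(\frac{L(f(x^0)-f_* )}{\varepsilon^2}\min\left\{\sqrt m,\max\left\{1,\frac{\sigma}{\varepsilon}\right\}\right\}+\min\left\{m,\max\left\{1,\frac{\sigma^2}{\varepsilon^2}\right\}\right\}\right)$$ evaluations of gradients $\nabla f_i(x)$ of individual summands, where $O(\cdot)$ hides only an absolute constant.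
   Context: $\|\cdot\|_2$ is the Euclidean norm on $\mathbb{R}^n$. One evaluation means computing $\nabla f_i(x)$ for one index $i$ at one point $x$; computing $\nabla f(x)$ costs $m$ evaluations. If $\sigma^2=+\infty$ then $r=+\infty$ and $q=m$. When $r<m$, $r$ is understood to be an integer, and $\hat N$ given by the formula is understood as an integer (rounding is ignored). *)

(* Defs.v *)
From HB Require Import structures.
From mathcomp Require Import all_boot all_order all_algebra.
From mathcomp Require Import all_classical all_reals all_analysis.
Set Implicit Arguments.
Unset Strict Implicit.
Unset Printing Implicit Defensive.
Import Order.TTheory GRing.Theory Num.Theory.
Import numFieldNormedType.Exports.
Local Open Scope classical_set_scope.
Local Open Scope ring_scope.

Section Euclidean.
Context {R : realType} {n : nat}.

(* The library norm `|v| on row vectors is the sup norm; it induces the same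
   topology, hence the same notion of differentiability. *)
Definition norm2 (v : 'rV[R]_n) : R := Num.sqrt (\sum_j v 0 j ^+ 2).

Definition grad (f : 'rV[R]_n -> R) (x : 'rV[R]_n) : 'rV[R]_n :=
  \row_j 'D_(delta_mx 0 j) f x.

Definition mean m (F : 'I_m -> 'rV[R]_n -> R) (x : 'rV[R]_n) : R :=
  m%:R^-1 * \sum_i F i x.

(* The expectation of |grad f_xi x - grad f x|^2 for xi uniform on 'I_m. *)
Definition grad_variance m (F : 'I_m -> 'rV[R]_n -> R) (x : 'rV[R]_n) : R :=
  m%:R^-1 * \sum_i norm2 (grad (F i) x - grad (mean F) x) ^+ 2.

End Euclidean.

Section Independence.
Context {d : measure_display} {T : measurableType d} {R : realType}.
Variable P : probability T R.

(* The family of classes of events (G a), a in D, is independent: the product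
   rule holds for every finite subfamily. *)
Definition independent_classes (I : eqType) (D : set I)
    (G : I -> set (set T)) : Prop :=
  forall s : seq I, uniq s -> [set` s] `<=` D ->
  forall E : I -> set T, (forall a, a \in s -> G a (E a)) ->
  P (\bigcap_(a in [set` s]) E a) = (\prod_(a <- s) P (E a))%E.

(* The events determined by a random element X of a discrete space V. *)
Definition events_of (V : Type) (X : T -> V) : set (set T) :=
  [set X @^-1` B | B in [set: set V]].

(* X is a random variable, uniformly distributed on 'I_p. *)
Definition uniform_on p (X : T -> 'I_p) : Prop :=
  forall i, measurable (X @^-1` [set i]) /\
            P (X @^-1` [set i]) = (p%:R^-1)%:E.

End Independence.

Section Method.
Context {R : realType} (n m : nat).
Variables (F : 'I_m -> 'rV[R]_n -> R) (L eps : R) (sigma2 : \bar R).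

(* r and q of the method; r may be infinite, q is always finite. *)
Definition batch : \bar R :=
  maxe 1%E ((20 / eps ^+ 2)%:E * sigma2)%E.

Definition period : R := fine (mine batch m%:R%:E).

Definition stepsize : R := (10 * L * Num.sqrt period)^-1.

(* Below, the natural number r is the value of [batch] when batch < m, and is
   irrelevant otherwise; the members of the minibatch are numbered from 0. *)
Variable r : nat.

Definition restart_batch (k : nat) : bool := (batch < m%:R%:E)%E && (r %| k)%N.
Definition restart_full (k : nat) : bool := (m%:R%:E <= batch)%E && (m %| k)%N.

(* g^k, from the minibatch xb = (xi_{k,j})_j, the index i = xi_k, and the values
   x = x^k, x' = x^{k-1}, g' = g^{k-1}. The primed ones are not used if k = 0,
   since 0 is always a restart. *)
Definition direction (k : nat) (xb : nat -> 'I_m) (i : 'I_m)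
    (x x' g' : 'rV[R]_n) : 'rV[R]_n :=
  if restart_batch k then r%:R^-1 *: \sum_(j < r) grad (F (xb j)) x
  else if restart_full k then grad (mean F) x
  else grad (F i) x - grad (F i) x' + g'.

(* The pairs (index, point) at which a summand gradient is evaluated in order
   to form [direction k xb i x x' g']; each entry is one evaluation. *)
Definition evaluations (k : nat) (xb : nat -> 'I_m) (i : 'I_m)
    (x x' : 'rV[R]_n) : seq ('I_m * 'rV[R]_n) :=
  if restart_batch k then [seq (xb j, x) | j <- iota 0 r]
  else if restart_full k then [seq (j, x) | j <- enum 'I_m]
  else [:: (i, x); (i, x')].

(* All random choices are labelled by [option (nat * nat + nat)]:
   Some (inl (k, j)) stands for xi_{k,j}, Some (inr k) for xi_k, and None for
   the choice of the output iterate. [used] selects those actually drawn. *)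
Definition used (a : option (nat * nat + nat)) : bool :=
  match a with
  | Some (inl (k, j)) => restart_batch k && (j < r)%N
  | Some (inr k) => ~~ restart_batch k && ~~ restart_full k
  | None => true
  end.

Definition choice_events (d : measure_display) (T : measurableType d) (N : nat)
    (xb : nat -> nat -> T -> 'I_m) (xi : nat -> T -> 'I_m) (tau : T -> 'I_N.+1)
    (a : option (nat * nat + nat)) : set (set T) :=
  match a with
  | Some (inl (k, j)) => events_of (xb k j)
  | Some (inr k) => events_of (xi k)
  | None => events_of tau
  end.

End Method.

(* Main.v *)
Require Import Defs.
From HB Require Import structures.
From mathcomp Require Import all_boot all_order all_algebra.
From mathcomp Require Import all_classical all_reals all_analysis.
From mathcomp Require Import measurable_realfun zify ring lra.
Set Implicit Arguments.
Unset Strict Implicit.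
Unset Printing Implicit Defensive.
Import Order.TTheory GRing.Theory Num.Theory.
Import numFieldNormedType.Exports.
Local Open Scope classical_set_scope.
Local Open Scope ring_scope.

(** The method is a variance-reduced gradient descent, and the proof balances
two opposite effects.

If [e] is the error of the direction [g] at [x], the descent inequality of an
[L]-smooth function and the identity
[2 <grad f x, g> = |grad f x|^2 + |g|^2 - |e|^2] give
[f (x - h g) + h/2 |grad f x|^2 + h/2 (1 - L h) |g|^2 <= f x + h/2 |e|^2]
([descent_step], where [L h <= 1/10]).  On the other side, at a restart the mean square of [e]
is at most [eps^2/20], since a minibatch of size [r] divides the variance by [r]
([avg_error_batch]); at any other time [e] is changed by an increment of
conditional mean zero, whose mean square is at most
[L^2 |x^k - x^(k-1)|^2 = L^2 h^2 |g^(k-1)|^2] ([avg_error_step]).  Increments of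
mean zero are orthogonal to the past, so mean squares add up; as periods have
length [q], the sum up to time [N] of the mean square errors is at most
[(N+1) eps^2/20 + L^2 h^2 q sum_k E |g^k|^2] ([sum_restarted_le]).  The step size
is such that [L^2 h^2 q = 1/100], so the terms in [|g|^2] on the left absorb
those on the right, and the sum telescopes to
[sum_k E |grad f x^k|^2 <= 2 (f x0 - fstar)/h + (N+1) eps^2/20]
([sum_avg_grad_le]), where [2/h = 20 L sqrt q].  This is stronger than the
constants of the theorem, as [20 <= 2000/23] and [1/20 <= 33/46].

All randomness is discrete: up to time [N] everything is a function of finitely
many independent uniform indices.  Hence every expectation is a plain average
over the finite set of their joint values ([avg], [expectation_avg],
[joint_law]), for which no question of measurability arises, and conditional
mean zero is a statement about resampling one index ([avg_resample]). *)

(** * Euclidean geometry and smooth functions *)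

Section InnerProduct.
Context {R : realType} {n : nat}.
Implicit Types u v w : 'rV[R]_n.

Definition dot u v : R := \sum_j u 0 j * v 0 j.

Lemma norm2_ge0 u : 0 <= norm2 u.
Proof. exact: sqrtr_ge0. Qed.

Lemma norm2_sqr u : norm2 u ^+ 2 = dot u u.
Proof.
rewrite /norm2 sqr_sqrtr; last by apply: sumr_ge0 => j _; exact: sqr_ge0.
by apply: eq_bigr => j _; rewrite expr2.
Qed.

Lemma dotC u v : dot u v = dot v u.
Proof. by apply: eq_bigr => j _; rewrite mulrC. Qed.

Lemma dotDl u v w : dot (u + v) w = dot u w + dot v w.
Proof. by rewrite -big_split; apply: eq_bigr => j _; rewrite mxE mulrDl. Qed.

Lemma dotZl a u v : dot (a *: u) v = a * dot u v.
Proof. by rewrite mulr_sumr; apply: eq_bigr => j _; rewrite mxE mulrA. Qed.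

Lemma dot0l v : dot 0 v = 0.
Proof. by rewrite -(scale0r 0) dotZl mul0r. Qed.

Lemma dotBl u v w : dot (u - v) w = dot u w - dot v w.
Proof. by rewrite -scaleN1r dotDl dotZl mulN1r. Qed.

Lemma dotDr u v w : dot u (v + w) = dot u v + dot u w.
Proof. by rewrite !(dotC u) dotDl. Qed.

Lemma dotZr a u v : dot u (a *: v) = a * dot u v.
Proof. by rewrite !(dotC u) dotZl. Qed.

Lemma dotBr u v w : dot u (v - w) = dot u v - dot u w.
Proof. by rewrite !(dotC u) dotBl. Qed.

Lemma dot_suml (I : finType) (u : I -> 'rV[R]_n) v :
  dot (\sum_i u i) v = \sum_i dot (u i) v.
Proof.
rewrite exchange_big; apply: eq_bigr => j _.
by rewrite summxE mulr_suml.
Qed.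

Lemma norm2_sqrZ a u : norm2 (a *: u) ^+ 2 = a ^+ 2 * norm2 u ^+ 2.
Proof. by rewrite !norm2_sqr dotZl dotZr mulrA -expr2. Qed.

Lemma norm2_sqrD u v :
  norm2 (u + v) ^+ 2 = norm2 u ^+ 2 + 2 * dot u v + norm2 v ^+ 2.
Proof. by rewrite !norm2_sqr dotDl !dotDr (dotC v u); ring. Qed.

Lemma norm2_sqrB u v :
  norm2 (u - v) ^+ 2 = norm2 u ^+ 2 - 2 * dot u v + norm2 v ^+ 2.
Proof. by rewrite !norm2_sqr dotBl !dotBr (dotC v u); ring. Qed.

(** Young's inequality, used in place of Cauchy-Schwarz: with [s] equal to the
Lipschitz factor it gives the same bound when [|u| <= s |v|]. *)
Lemma dot_le_young s u v : 0 < s ->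
  2 * s * dot u v <= norm2 u ^+ 2 + s ^+ 2 * norm2 v ^+ 2.
Proof.
move=> s0; have := sqr_ge0 (norm2 (u - s *: v)).
by rewrite norm2_sqrB norm2_sqrZ dotZr; lra.
Qed.

(** The mean minimizes the sum of the squared distances, so centering does
not increase it. *)
Lemma variance_le m (D : 'I_m -> 'rV[R]_n) (c := m%:R^-1 *: \sum_i D i) :
  (0 < m)%N ->
  \sum_i norm2 (D i - c) ^+ 2 <= \sum_i norm2 (D i) ^+ 2.
Proof.
move=> m0; have m0' : (m%:R : R) != 0 by rewrite pnatr_eq0 -lt0n.
under eq_bigr do rewrite norm2_sqrB.
rewrite big_split /= sumrB -mulr_sumr -dot_suml sumr_const card_ord.
have -> : \sum_i D i = m%:R *: c by rewrite scalerA divff// scale1r.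
rewrite dotZl -norm2_sqr -mulr_natl.
have := mulr_ge0 (ler0n R m) (sqr_ge0 (norm2 c)); lra.
Qed.

Lemma derive_grad (f : 'rV[R]_n -> R) x v : differentiable f x ->
  'D_v f x = dot (grad f x) v.
Proof.
move=> df; rewrite deriveE// [in LHS](row_sum_delta v) linear_sum.
apply: eq_bigr => j _; rewrite linearZ /= mxE deriveE//.
by rewrite mulrC.
Qed.

Lemma grad_mean m (F : 'I_m -> 'rV[R]_n -> R) x :
  (forall i, differentiable (F i) x) ->
  grad (mean F) x = m%:R^-1 *: \sum_i grad (F i) x.
Proof.
move=> dF; apply/rowP => j; rewrite !mxE summxE.
have -> : mean F = m%:R^-1 *: \sum_i F i.
  by apply/funext => y; rewrite /mean /= fct_sumE.
have dFj i : derivable (F i) x (delta_mx 0 j) by exact: diff_derivable.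
rewrite deriveZ; last exact: derivable_sum.
rewrite derive_sum//; congr (_ * _).
by apply: eq_bigr => i _; rewrite mxE.
Qed.

(** Along the segment from [x] to [x + v], the difference between [f] and its
quadratic upper model has nonpositive derivative. *)
Lemma smooth_descent (f : 'rV[R]_n -> R) (L : R) x v : 0 < L ->
  (forall y, differentiable f y) ->
  (forall y z, norm2 (grad f y - grad f z) <= L * norm2 (y - z)) ->
  f (x + v) <= f x + dot (grad f x) v + L / 2 * norm2 v ^+ 2.
Proof.
move=> L0 df fL.
pose phi (t : R) := f (x + t *: v) - t * dot (grad f x) v - L / 2 * norm2 v ^+ 2 * t ^+ 2.
pose dphi (t : R) := dot (grad f (x + t *: v)) v - dot (grad f x) v
    - L * norm2 v ^+ 2 * t.
have dphiE (t : R) : is_derive t 1 phi (dphi t).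
  have dline : is_derive t 1 (fun s : R => f (x + s *: v)) (dot (grad f (x + t *: v)) v).
    have dl : is_diff t (fun s : R => x + s *: v) (fun s : R => s *: v).
      by apply: is_diff_eq; rewrite add0r.
    have dfl : differentiable (f \o (fun s : R => x + s *: v)) t.
      by apply: differentiable_comp.
    apply: DeriveDef; first exact/derivable1_diffP.
    rewrite deriveE// diff_comp//.
    by rewrite /= diff_val scale1r -deriveE// derive_grad.
  apply: is_derive_eq.
  by rewrite /dphi /GRing.scale /=; field.
suff : phi 1 <= phi 0.
  by rewrite /phi scale1r scale0r addr0 expr1n expr0n /=; lra.
apply: (@ler0_derive1_le_cc _ phi 0 1); rewrite ?in_itv /= ?lexx ?ler01 //.
- move=> t; rewrite in_itv /= => /andP[t0 _].
  rewrite derive1E derive_val /dphi.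
  have := dot_le_young (grad f (x + t *: v) - grad f x) v (mulr_gt0 L0 t0).
  have : norm2 (grad f (x + t *: v) - grad f x) ^+ 2 <= (L * t) ^+ 2 * norm2 v ^+ 2.
    have := fL (x + t *: v) x; rewrite addrAC subrr add0r => fLt.
    rewrite exprMn -mulrA -norm2_sqrZ -exprMn.
    by apply: lerXn2r fLt; rewrite nnegrE ?mulr_ge0 ?norm2_ge0// ltW.
  rewrite dotBl => H1 H2.
  rewrite -(ler_pM2l (mulr_gt0 L0 t0)); lra.
- by apply: derivable_within_continuous => t _.
Qed.

(** Averaging the inequality of the summands avoids proving that the
gradient of the mean is Lipschitz. *)
Lemma mean_descent m (F : 'I_m -> 'rV[R]_n -> R) (L : R) x v : (0 < m)%N -> 0 < L ->
  (forall i y, differentiable (F i) y) ->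
  (forall i y z, norm2 (grad (F i) y - grad (F i) z) <= L * norm2 (y - z)) ->
  mean F (x + v) <= mean F x + dot (grad (mean F) x) v + L / 2 * norm2 v ^+ 2.
Proof.
move=> m0 L0 dF FL; have m0' : (m%:R : R) != 0 by rewrite pnatr_eq0 -lt0n.
rewrite grad_mean// dotZl dot_suml /mean -mulrDr -big_split /=.
have -> : L / 2 * norm2 v ^+ 2 = m%:R^-1 * \sum_(i < m) L / 2 * norm2 v ^+ 2.
  by rewrite sumr_const card_ord -[_ * _ *+ m]mulr_natl mulKf.
rewrite -mulrDr -big_split ler_pM2l ?invr_gt0 ?ltr0n//=.
by apply: ler_sum => i _; exact: smooth_descent.
Qed.

End InnerProduct.

(** * Averages over finitely many independent uniform indices *)

Section Averaging.
Context {R : realType} {A : choiceType} {m : nat} (i0 : 'I_m) (s : seq A).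

(** An assignment of values to the labels in [s], made total with the default
value [i0] so that functions of all labels can be averaged. *)
Definition extend (z : {ffun seq_sub s -> 'I_m}) (a : A) : 'I_m :=
  if insub a is Some u then z u else i0.

(** The expectation of [phi] when the labels in [s] are independent and
uniform. *)
Definition avg (phi : (A -> 'I_m) -> R) : R :=
  #|{ffun seq_sub s -> 'I_m}|%:R^-1 * \sum_z phi (extend z).

(** The pointwise form of independence from the index labelled [a]. *)
Definition ignores V (a : A) (phi : (A -> 'I_m) -> V) : Prop :=
  forall c c', (forall b, b != a -> c b = c' b) -> phi c = phi c'.

Lemma card_choices_gt0 : 0 < #|{ffun seq_sub s -> 'I_m}|%:R :> R.
Proof.
by rewrite ltr0n; apply/card_gt0P; exists [ffun=> i0].
Qed.

Lemma eq_avg phi psi : phi =1 psi -> avg phi = avg psi.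
Proof. by move=> e; congr (_ * _); apply: eq_bigr => z _; exact: e. Qed.

Lemma le_avg phi psi : (forall c, phi c <= psi c) -> avg phi <= avg psi.
Proof.
move=> le; rewrite ler_pM2l ?invr_gt0 ?card_choices_gt0//.
by apply: ler_sum => z _; exact: le.
Qed.

Lemma avg_cst k : avg (fun=> k) = k.
Proof.
by rewrite /avg sumr_const -[k *+ _]mulr_natl mulKf// gt_eqF ?card_choices_gt0.
Qed.

Lemma avgD phi psi : avg (fun c => phi c + psi c) = avg phi + avg psi.
Proof. by rewrite /avg big_split mulrDr. Qed.

Lemma avgZ k phi : avg (fun c => k * phi c) = k * avg phi.
Proof. by rewrite /avg -mulr_sumr mulrCA. Qed.

(** Taking the conditional expectation with respect to all labels but [a]: the
map that exchanges the value at [a] with an independent fresh index is a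
bijection. *)
Lemma avg_resample a (Y : 'I_m -> (A -> 'I_m) -> R) : a \in s ->
  (forall i, ignores a (Y i)) ->
  avg (fun c => Y (c a) c) = avg (fun c => m%:R^-1 * \sum_i Y i c).
Proof.
move=> sa Ya; congr (_ * _).
pose u : seq_sub s := SeqSub sa.
have extu z : extend z a = z u.
  rewrite /extend; case: insubP => [v _ va|]; last by rewrite sa.
  by congr (z _); apply/val_inj.
pose upd (z : {ffun seq_sub s -> 'I_m}) (i : 'I_m) : {ffun seq_sub s -> 'I_m} :=
  [ffun v => if v == u then i else z v].
have updY z i j : Y i (extend (upd z j)) = Y i (extend z).
  apply: Ya => b ba; rewrite /extend; case: insubP => // v _ vb.
  by rewrite ffunE; case: eqP => // vu; rewrite -vb vu eqxx in ba.
rewrite -mulr_sumr.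
(* The involution of pairs (assignment, fresh index). *)
pose swap (p : {ffun seq_sub s -> 'I_m} * 'I_m) := (upd p.1 p.2, p.1 u).
have swapK : involutive swap.
  move=> [z i]; rewrite /swap /= !ffunE eqxx; congr pair.
  by apply/ffunP => v; rewrite !ffunE; case: eqP => [->|].
rewrite (pair_bigA _ (fun z i => Y i (extend z))) /=.
rewrite (reindex_inj (inv_inj swapK)) /=.
rewrite (eq_bigr (fun p : {ffun seq_sub s -> 'I_m} * 'I_m =>
  Y (extend p.1 a) (extend p.1))); last first.
  by move=> p _; rewrite updY extu.
rewrite -(pair_bigA _ (fun z (i : 'I_m) => Y (extend z a) (extend z))) /=.
rewrite mulr_sumr; apply: eq_bigr => z _.
have m0 : (m%:R : R) != 0 by rewrite pnatr_eq0 -lt0n (leq_ltn_trans _ (ltn_ord i0)).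
by rewrite sumr_const card_ord -[Y _ _ *+ _]mulr_natl mulKf.
Qed.

(** Pythagoras for martingale increments: given all labels but [a], the
increment has mean zero, so the cross term vanishes. *)
Lemma avg_orthogonal_increment n a (V : (A -> 'I_m) -> 'rV[R]_n)
    (D : 'I_m -> (A -> 'I_m) -> 'rV[R]_n) :
  a \in s -> ignores a V -> (forall i, ignores a (D i)) ->
  (forall c, \sum_i D i c = 0) ->
  avg (fun c => norm2 (V c + D (c a) c) ^+ 2) =
  avg (fun c => norm2 (V c) ^+ 2) +
  avg (fun c => m%:R^-1 * \sum_i norm2 (D i c) ^+ 2).
Proof.
move=> sa Va Da D0.
rewrite (avg_resample (Y := fun i c => norm2 (V c + D i c) ^+ 2))//; last first.
  by move=> i c c' cc'; rewrite (Va _ _ cc') (Da _ _ _ cc').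
rewrite -avgD; apply: eq_avg => c.
have m0 : (m%:R : R) != 0 by rewrite pnatr_eq0 -lt0n (leq_ltn_trans _ (ltn_ord i0)).
under eq_bigr do rewrite norm2_sqrD dotC.
rewrite !big_split /= -[\sum_(i < m) 2 * _]mulr_sumr.
rewrite -[\sum_(i < m) dot _ _]dot_suml D0 dot0l mulr0 addr0.
by rewrite sumr_const card_ord mulrDr -[_ ^+ 2 *+ _]mulr_natl mulKf.
Qed.

(** The function under the expectation is a finite combination of indicators of
the joint events of [law], all of which have the same probability. *)
Lemma expectation_avg d (Omega : measurableType d) (P : probability Omega R)
    (var : A -> Omega -> 'I_m) N (tau : Omega -> 'I_N.+1)
    (Y : 'I_N.+1 -> (A -> 'I_m) -> R) :
  (forall t z,
     let E := [set w | tau w = t /\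
       forall a, a \in s -> var a w = extend z a] in
     measurable E /\
     P E = (N.+1%:R^-1 * #|{ffun seq_sub s -> 'I_m}|%:R^-1)%:E) ->
  (forall t c, 0 <= Y t c) ->
  (forall t c c', (forall a, a \in s -> c a = c' a) -> Y t c = Y t c') ->
  ('E_P[fun w => Y (tau w) (var^~ w)] = (N.+1%:R^-1 * \sum_t avg (Y t))%:E)%E.
Proof.
move=> law Y0 Ys; rewrite unlock.
pose W := {ffun seq_sub s -> 'I_m}.
pose E (p : 'I_N.+1 * W) :=
  [set w | tau w = p.1 /\ forall a, a \in s -> var a w = extend p.2 a].
have YE w : ((Y (tau w) (var^~ w))%:E =
    \sum_(p : 'I_N.+1 * W) ((Y p.1 (extend p.2))%:E * (\1_(E p) w)%:E))%E.
  pose z : W := [ffun v => var (val v) w].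
  have zs a : a \in s -> var a w = extend z a.
    by move=> sa; rewrite /extend; case: insubP => [v _ <-|]; rewrite ?ffunE ?sa.
  rewrite (bigD1 (tau w, z))//= big1 ?adde0.
    by rewrite indicE mem_set// mule1 (Ys _ _ (extend z)).
  move=> [t z'] /= ne; rewrite indicE memNset ?mule0//= => -[/= tt zz'].
  move/eqP: ne; apply; congr pair => //; apply/ffunP => v.
  have := zz' _ (valP v); rewrite zs ?(valP v)// /extend.
  by rewrite valK.
under eq_integral do rewrite YE.
rewrite ge0_integral_sum//; last 2 first.
- move=> p; apply: emeasurable_funM => //; apply/measurable_EFinP.
  exact: measurable_indic (law p.1 p.2).1.
- by move=> p w _; rewrite -EFinM lee_fin mulr_ge0.
rewrite (eq_bigr (fun p => (Y p.1 (extend p.2) *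
   (N.+1%:R^-1 * #|{ffun seq_sub s -> 'I_m}|%:R^-1))%:E)); last first.
  move=> [t z] _; have [mE PE] := law t z; rewrite ge0_integralZl//=.
  + by rewrite integral_indic// setIT EFinM -PE.
  + by apply/measurable_EFinP; exact: measurable_indic.
  + by rewrite lee_fin.
rewrite sumEFin; congr EFin.
rewrite -(pair_bigA _ (fun t z => Y t (extend z) *
   (N.+1%:R^-1 * #|{ffun seq_sub s -> 'I_m}|%:R^-1))) /=.
rewrite mulr_sumr; apply: eq_bigr => t _.
by rewrite -mulr_suml /avg mulrC mulrA.
Qed.

End Averaging.

(** * Periodic sums *)

(** Proved through the closed form of the sum, which unlike the bound is stable
under induction on [M]. *)
Lemma sum_div_eq_le q c M : (0 < q)%N -> (\sum_(k < M) (k %/ q == c) <= q)%N.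
Proof.
move=> q0; suff -> : (\sum_(k < M) (k %/ q == c) = minn q (M - c * q))%N.
  exact: geq_minl.
elim: M => [|M IH]; first by rewrite big_ord0 sub0n minn0.
rewrite big_ord_recr IH /= eqn_leq -ltnS ltn_divLR// leq_divRL// mulSn.
by case: (leqP (c * q) M) => ?; case: (ltnP M (q + c * q)) => ? /=; lia.
Qed.

(** Within its period, [E k] is bounded by [delta] plus [beta] times the sum of
the earlier [G l], and each [G l] is counted by at most [q] indices [k]. *)
Lemma sum_restarted_le (R : realFieldType) (E G : nat -> R) (delta beta : R)
    (q M : nat) :
  (0 < q)%N -> 0 <= beta -> (forall k, 0 <= G k) ->
  (forall k, (k < M)%N -> (q %| k)%N -> E k <= delta) ->
  (forall k, (k.+1 < M)%N -> ~~ (q %| k.+1)%N ->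
     E k.+1 <= E k + beta * G k) ->
  \sum_(k < M) E k <= M%:R * delta + beta * q%:R * \sum_(k < M) G k.
Proof.
move=> q0 beta0 G0 Erestart Estep.
have Ek k : (k < M)%N ->
    E k <= delta + beta * \sum_(l < k | (k %/ q == l %/ q)%N) G l.
  have sum_ge0 j : 0 <= beta * \sum_(l < j | (j %/ q == l %/ q)%N) G l.
    by rewrite mulr_ge0// sumr_ge0.
  elim: k => [|k IH] kM.
    by apply: (le_trans (Erestart _ kM (dvdn0 _))); rewrite lerDl.
  have [qk|qk] := boolP (q %| k.+1)%N.
    by apply: (le_trans (Erestart _ kM qk)); rewrite lerDl.
  apply: (le_trans (Estep _ kM qk)).
  have e : (k.+1 %/ q = k %/ q)%N by rewrite divnS// (negbTE qk).
  rewrite big_mkcond big_ord_recr /= e eqxx mulrDr addrA lerD2r.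
  by rewrite -big_mkcond; exact/IH/ltnW.
apply: (@le_trans _ _ (\sum_(k < M) (delta + beta *
    \sum_(l < M) (k %/ q == l %/ q)%N%:R * G l))).
  apply: ler_sum => k _; apply: (le_trans (Ek k (ltn_ord k))).
  rewrite lerD2l ler_wpM2l//.
  rewrite (big_ord_widen_cond M (fun l => k %/ q == l %/ q)%N G) ?(ltnW (ltn_ord k))//.
  rewrite big_mkcond; apply: ler_sum => l _.
  by case: eqP => _ /=; rewrite ?mul1r ?mul0r//; case: ifP.
rewrite big_split /= sumr_const card_ord -[delta *+ _]mulr_natl lerD2l.
rewrite -mulr_sumr -mulrA ler_wpM2l// exchange_big mulr_sumr.
apply: ler_sum => l _; rewrite -mulr_suml ler_wpM2r//.
by rewrite -natr_sum ler_nat; exact: sum_div_eq_le.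
Qed.

(** There are [M / q + 1] restarts of cost [q], time 0 included, and at most [M]
other steps of cost 2. *)
Lemma sum_period_cost q M : (0 < q)%N ->
  (\sum_(k < M.+1) (if q %| k then q else 2) <= 3 * M + 3 * q)%N.
Proof.
move=> q0; apply: (@leq_trans (q * (M %/ q).+1 + 2 * M)%N); last first.
  by have := leq_trunc_div M q; nia.
elim: M => [|M IH]; first by rewrite big_ord_recr big_ord0 /= dvdn0 div0n; lia.
rewrite big_ord_recr /= divnS//; move: IH; case: (q %| M.+1)%N => /=; nia.
Qed.

(** * The parameters of the method *)

Section BatchSize.
Context {R : realType} (m : nat) (eps : R) (sigma2 : \bar R) (r : nat).
Hypothesis m_gt0 : (0 < m)%N.
Hypothesis eps_gt0 : 0 < eps.
Hypothesis sigma2_ge0 : (0 <= sigma2)%E.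
Hypothesis batchE : (batch eps sigma2 < m%:R%:E)%E -> batch eps sigma2 = r%:R%:E.

(** The period [q] as a natural number; see [periodE]. *)
Definition nperiod : nat := if (batch eps sigma2 < m%:R%:E)%E then r else m.

Lemma batch_ge1 : (1 <= batch eps sigma2)%E.
Proof. by rewrite /batch le_max lexx. Qed.

Lemma periodE : period m eps sigma2 = nperiod%:R.
Proof.
rewrite /period /nperiod; by case: ltP => // bm; rewrite batchE.
Qed.

Lemma nperiod_gt0 : (0 < nperiod)%N.
Proof.
rewrite /nperiod; case: ltP => // bm; have := batch_ge1.
by rewrite batchE// lee_fin ler1n.
Qed.

(** The batch size decides which of the two kinds of restart occurs, once and for
all [k]; the other kind never does. *)
Lemma restartE k :
  restart_batch m eps sigma2 r k || restart_full m eps sigma2 k = (nperiod %| k)%N.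
Proof.
by rewrite /restart_batch /restart_full /nperiod; case: ltP => _; rewrite ?orbF.
Qed.

(** Here [r] is the batch size, which is at least [20 sigma^2/eps^2]. *)
Lemma variance_le_batch (v : R) : (v%:E <= sigma2)%E ->
  (batch eps sigma2 < m%:R%:E)%E -> v <= r%:R * (eps ^+ 2 / 20).
Proof.
move=> vs bm; have e2 : 0 < eps ^+ 2 by rewrite exprn_gt0.
have : ((20 / eps ^+ 2)%:E * v%:E <= r%:R%:E)%E.
  rewrite -(batchE bm) /batch le_max; apply/orP; right.
  by apply: lee_wpmul2l => //; rewrite lee_fin divr_ge0// ltW.
rewrite -EFinM lee_fin mulrAC ler_pdivrMr// => H.
rewrite mulrA ler_pdivlMr//; lra.
Qed.

Lemma periodEFin : (period m eps sigma2)%:E = mine (batch eps sigma2) m%:R%:E.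
Proof.
rewrite /period; case: (ltP (batch eps sigma2) m%:R%:E) => [bm|//].
by rewrite batchE.
Qed.

Lemma sqrt_min (a b : R) : Num.sqrt (Num.min a b) = Num.min (Num.sqrt a) (Num.sqrt b).
Proof.
by case: (leP a b) => [/ler_wsqrtr/min_l->|/ltW/ler_wsqrtr/min_r->].
Qed.

Lemma sqrt_max (a b : R) : Num.sqrt (Num.max a b) = Num.max (Num.sqrt a) (Num.sqrt b).
Proof.
by case: (leP a b) => [/ler_wsqrtr/max_r->|/ltW/ler_wsqrtr/max_l->].
Qed.

Lemma sqrt_period : (Num.sqrt (period m eps sigma2))%:E =
  mine (Num.sqrt m%:R)%:E (maxe 1 ((Num.sqrt 20 / eps)%:E * sqrte sigma2))%E.
Proof.
have e0 : 0 < 20 / eps ^+ 2 by rewrite divr_gt0// exprn_gt0.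
have se0 : 0 < Num.sqrt 20 / eps by rewrite divr_gt0// sqrtr_gt0.
rewrite /period /batch; case: sigma2 sigma2_ge0 => [s||//] s0 /=.
  rewrite -!EFinM -!EFin_max -!EFin_min /= sqrt_min sqrt_max sqrtr1 minC.
  rewrite sqrtrM ?ltW// sqrtrM// sqrtrV ?sqr_ge0// sqrtr_sqr ger0_norm//.
  exact: ltW.
by rewrite !gt0_muley ?lte_fin// !maxey min_r ?leey//= min_l ?leey.
Qed.

Lemma min_max1_le (K A x y : R) : 1 <= K -> 0 <= A -> x <= K * y ->
  Num.min A (Num.max 1 x) <= K * Num.min A (Num.max 1 y).
Proof.
move=> K1 A0 xy; rewrite minr_pMr ?maxr_pMr ?(le_trans ler01)// mulr1.
have AKA : A <= K * A by rewrite ler_peMl.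
by rewrite le_min2// le_max2.
Qed.

(** Moving the factors [20] and [sqrt 20 <= 5] out of the minima turns the
parameters of the method into the rates of the complexity bound. *)
Lemma period_le_rates : exists a b : R,
  [/\ mine (Num.sqrt m%:R)%:E (maxe 1 ((eps^-1)%:E * sqrte sigma2))%E = a%:E,
      mine m%:R%:E (maxe 1 ((eps ^- 2)%:E * sigma2))%E = b%:E,
      Num.sqrt (period m eps sigma2) <= 5 * a &
      period m eps sigma2 <= 20 * b].
Proof.
have e0 : 0 < eps^-1 by rewrite invr_gt0.
have e2 : 0 < eps ^- 2 by rewrite invr_gt0 exprn_gt0.
have s20 : Num.sqrt 20 <= 5 :> R.
  by rewrite -[leRHS]ger0_norm// -sqrtr_sqr ler_wsqrtr//; lra.
have := periodEFin; have := sqrt_period; rewrite /batch.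
case: sigma2 sigma2_ge0 => [s||//] s0 /=.
  rewrite -!EFinM -!EFin_max -!EFin_min => -[-> [->]].
  eexists; eexists; split; [reflexivity|reflexivity| |].
    apply: min_max1_le; rewrite ?sqrtr_ge0 ?ler1n//.
    by rewrite -mulrA ler_wpM2r// mulr_ge0 ?sqrtr_ge0// ltW.
  by rewrite minC; apply: min_max1_le; rewrite ?ler1n// mulrA.
rewrite !gt0_muley ?lte_fin// ?divr_gt0 ?sqrtr_gt0 ?exprn_gt0//.
rewrite !maxey !miney => -[->] [->]; exists (Num.sqrt m%:R), m%:R.
split=> //; first by rewrite ler_peMl ?sqrtr_ge0 ?ler1n.
by rewrite ler_peMl ?ler1n.
Qed.

End BatchSize.

(** * The iterates and their error *)

Definition label : Type := (nat * nat + nat)%type.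

(** The iteration at which an index is drawn. *)
Definition time (a : label) : nat :=
  match a with inl (k, _) => k | inr k => k end.

Definition outcome (m : nat) (Omega : Type) (xb : nat -> nat -> Omega -> 'I_m)
    (xi : nat -> Omega -> 'I_m) (a : label) : Omega -> 'I_m :=
  match a with inl (k, j) => xb k j | inr k => xi k end.

Section Iterates.
Context {R : realType} {n m : nat}.
Variables (F : 'I_m -> 'rV[R]_n -> R) (L eps : R) (sigma2 : \bar R).
Variables (x0 : 'rV[R]_n) (r : nat).
Hypothesis m_gt0 : (0 < m)%N.
Hypothesis batchE : (batch eps sigma2 < m%:R%:E)%E -> batch eps sigma2 = r%:R%:E.

Local Notation h := (stepsize m L eps sigma2).
Local Notation usedl := (fun a => used m eps sigma2 r (Some a)).
Local Notation q := (nperiod m eps sigma2 r).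

Definition draw (c : label -> 'I_m) (k : nat) (x x' g' : 'rV[R]_n) :=
  direction F eps sigma2 r k (fun j => c (inl (k, j))) (c (inr k)) x x' g'.

(** The pair of [x^k] and [g^k] as a deterministic function of the indices;
the arguments [x0] and [0] that stand for [x^(-1)] and [g^(-1)] are arbitrary,
since time 0 is a restart. *)
Fixpoint iterate (c : label -> 'I_m) (k : nat) : 'rV[R]_n * 'rV[R]_n :=
  if k is k'.+1 then
    let: (x', g') := iterate c k' in
    let x := x' - h *: g' in (x, draw c k x x' g')
  else (x0, draw c 0 x0 x0 0).

Definition position c k := (iterate c k).1.
Definition estimate c k := (iterate c k).2.

Lemma positionS c k : position c k.+1 = position c k - h *: estimate c k.
Proof. by rewrite /position /estimate /=; case: (iterate c k). Qed.

Lemma estimateS c k : estimate c k.+1 =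
  draw c k.+1 (position c k.+1) (position c k) (estimate c k).
Proof. by rewrite /position /estimate /=; case: (iterate c k). Qed.

Lemma draw_local c c' k x x' g' :
  (forall a, usedl a -> time a = k -> c a = c' a) ->
  draw c k x x' g' = draw c' k x x' g'.
Proof.
move=> cc'; rewrite /draw /direction.
case rk : (restart_batch m eps sigma2 r k).
  by congr (_ *: _); apply: eq_bigr => j _; rewrite cc'//= rk ltn_ord.
by case fk : (restart_full m eps sigma2 k); [|rewrite cc'//= rk fk].
Qed.

(** This makes the past of each step a function of finitely many indices: it gives
both the independence of the later indices and the reduction to [avg]. *)
Lemma iterate_local c c' k :
  (forall a, usedl a -> (time a <= k)%N -> c a = c' a) ->
  iterate c k = iterate c' k.
Proof.
elim: k => [|k IH] cc' /=.
  rewrite (@draw_local c c')// => a ua a0.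
  by apply: cc'; rewrite ?a0.
rewrite IH => [|a ua ak]; last by apply: cc' => //; exact: leqW.
case: (iterate c' k) => x g; rewrite (@draw_local c c')// => a ua ak.
by apply: cc'; rewrite ?ak.
Qed.

Lemma position_local c c' k :
  (forall a, usedl a -> (time a < k)%N -> c a = c' a) ->
  position c k = position c' k.
Proof.
case: k => [//|k] cc'; rewrite !positionS /position /estimate.
by rewrite (@iterate_local c c').
Qed.

Lemma position_ignores a k : (k <= time a)%N -> ignores a (position^~ k).
Proof.
move=> ka c c' cc'; apply: position_local => b _ bk; apply: cc'.
by apply: contraTneq bk => ->; rewrite -leqNgt.
Qed.

Lemma estimate_ignores a k : (k < time a)%N -> ignores a (estimate^~ k).
Proof.
move=> ka c c' cc'; rewrite /estimate (@iterate_local c c')// => b _ bk.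
by apply: cc'; apply: contraTneq bk => ->; rewrite -ltnNge.
Qed.

Lemma draw_restart c k x y y' g g' : (q %| k)%N ->
  draw c k x y g = draw c k x y' g'.
Proof.
by rewrite -restartE /draw /direction; case: ifP => // _ /= ->.
Qed.

Lemma estimateE c k :
  estimate c k = draw c k (position c k) (position c k.-1) (estimate c k.-1).
Proof. by case: k => [|k]; [exact: draw_restart|exact: estimateS]. Qed.

Lemma iterate_unique Omega (xb : nat -> nat -> Omega -> 'I_m)
    (xi : nat -> Omega -> 'I_m) (x g : nat -> Omega -> 'rV[R]_n) :
  (forall w, x 0%N w = x0) ->
  (forall k w, x k.+1 w = x k w - h *: g k w) ->
  (forall k w, g k w = direction F eps sigma2 r k (fun j => xb k j w) (xi k w)
                 (x k w) (x k.-1 w) (g k.-1 w)) ->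
  forall k w, x k w = position ((outcome xb xi)^~ w) k.
Proof.
move=> hx0 hx hg k w; suff : (x k w, g k w) = iterate ((outcome xb xi)^~ w) k.
  by rewrite /position => <-.
elim: k => [|k IH] /=; last by rewrite -IH hx [g k.+1 w]hg /= hx.
rewrite [g 0%N w]hg hx0.
by rewrite [X in (_, X)](@draw_restart ((outcome xb xi)^~ w) 0 x0 x0 x0 _ 0).
Qed.

Definition drawn (N : nat) : seq label :=
  undup [seq a <- [seq inl (k, j) | k <- iota 0 N.+1, j <- iota 0 r] ++
                  [seq inr k | k <- iota 0 N.+1] | usedl a].

Lemma mem_drawn N a : (a \in drawn N) = usedl a && (time a <= N)%N.
Proof.
have ksE k : (k \in iota 0 N.+1) = (k <= N)%N by rewrite mem_iota.
rewrite mem_undup mem_filter mem_cat; case: (boolP (usedl a)) => // ua.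
move: (iota 0 N.+1) ksE => ks ksE.
case: a ua => [[k j]|k] ua /=.
  rewrite [X in _ || X](_ : _ = false) ?orbF; last by apply/mapP => -[].
  apply/allpairsP/idP => [[[k' j'] /= [+ _ [-> _]]]|kN]; first by rewrite ksE.
  by exists (k, j); split; rewrite //= ?ksE// mem_iota; case/andP: ua.
rewrite [X in X || _](_ : _ = false) /=; last by apply/allpairsP => -[[? ?] []].
by apply/mapP/idP => [[k' + [->]]|kN]; [rewrite ksE|exists k; rewrite ?ksE].
Qed.

Hypothesis F_diff : forall i x, differentiable (F i) x.
Hypothesis L_gt0 : 0 < L.
Hypothesis F_smooth : forall i x y,
  norm2 (grad (F i) x - grad (F i) y) <= L * norm2 (x - y).
Hypothesis eps_gt0 : 0 < eps.
Hypothesis F_var : forall x, ((grad_variance F x)%:E <= sigma2)%E.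

Local Notation f := (mean F).
Local Notation i0 := (Ordinal m_gt0).

Let m_neq0 : (m%:R : R) != 0. Proof. by rewrite pnatr_eq0 -lt0n. Qed.

Definition error c k := estimate c k - grad f (position c k).

Lemma error_full c k : restart_full m eps sigma2 k -> error c k = 0.
Proof.
move=> fk; rewrite /error.
suff -> : estimate c k = grad f (position c k) by rewrite subrr.
have nb : restart_batch m eps sigma2 r k = false.
  by move: fk; rewrite /restart_full /restart_batch; case: ltP.
by rewrite estimateE /draw /direction nb fk.
Qed.

Lemma error_batch c k : restart_batch m eps sigma2 r k -> error c k =
  r%:R^-1 *: \sum_(j < r)
    (grad (F (c (inl (k, val j)))) (position c k) - grad f (position c k)).
Proof.
move=> bk.
have -> : error c k =
    r%:R^-1 *: (\sum_(j < r) grad (F (c (inl (k, val j)))) (position c k))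
    - grad f (position c k).
  by rewrite /error estimateE /draw /direction bk.
have r0 : (r%:R : R) != 0.
  have := nperiod_gt0 m_gt0 batchE; rewrite /nperiod pnatr_eq0 -lt0n.
  by case/andP: bk => ->.
rewrite sumrB scalerBr sumr_const card_ord -[grad _ _ *+ r]scaler_nat scalerA.
by rewrite mulVf// scale1r.
Qed.

Lemma error_recursive c k : ~~ (q %| k.+1)%N -> error c k.+1 =
  error c k +
  ((grad (F (c (inr k.+1))) (position c k.+1) - grad (F (c (inr k.+1))) (position c k))
   - (grad f (position c k.+1) - grad f (position c k))).
Proof.
rewrite -restartE negb_or => /andP[/negbTE nb /negbTE nf].
rewrite /error estimateS {1}/draw /direction nb nf.
set A := grad _ _; set B := grad _ _; set C := grad _ _; set D := grad _ _.
by rewrite opprB [RHS]addrACA addKr (addrC (A - B)).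
Qed.

Section Averages.
Variable N : nat.
Local Notation E := (avg i0 (drawn N)).

(** The deviations of the minibatch have mean zero given the earlier ones, so
their mean squares add up to at most [r] times the variance. *)
Lemma avg_error_batch k : (k <= N)%N -> restart_batch m eps sigma2 r k ->
  E (fun c => norm2 (error c k) ^+ 2) <= eps ^+ 2 / 20.
Proof.
move=> kN bk; have [bm qk] := andP bk.
pose D i c := grad (F i) (position c k) - grad f (position c k).
pose v := r%:R * (eps ^+ 2 / 20).
have Dvar c : m%:R^-1 * \sum_i norm2 (D i c) ^+ 2 <= v.
  exact: (variance_le_batch eps_gt0 batchE (F_var (position c k))).
have Dsum c : \sum_i D i c = 0.
  rewrite sumrB grad_mean// sumr_const card_ord -[_ *: _ *+ m]scaler_nat.
  by rewrite scalerA divff// scale1r subrr.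
have r0 : 0 < r%:R :> R.
  by have := nperiod_gt0 m_gt0 batchE; rewrite /nperiod bm ltr0n.
suff partial j : (j <= r)%N ->
    E (fun c => norm2 (\sum_(l < j) D (c (inl (k, val l))) c) ^+ 2) <= j%:R * v.
  rewrite (@eq_avg _ _ _ _ _ _ (fun c => r%:R ^- 2 *
    norm2 (\sum_(l < r) D (c (inl (k, val l))) c) ^+ 2)); last first.
    by move=> c; rewrite error_batch// norm2_sqrZ exprVn.
  rewrite avgZ ler_pdivrMl ?exprn_gt0//; apply: (le_trans (partial r _)) => //.
  by rewrite /v expr2; lra.
elim: j => [|j IH] jr.
  rewrite (@eq_avg _ _ _ _ _ _ (fun=> 0)) ?avg_cst ?mul0r// => c.
  by rewrite big_ord0 norm2_sqr dot0l.
have Dign a i : (k <= time a)%N -> ignores a (D i).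
  by move=> ka c c' cc'; rewrite /D (position_ignores ka cc').
pose a : label := inl (k, j).
rewrite (@eq_avg _ _ _ _ _ _ (fun c => norm2
   (\sum_(l < j) D (c (inl (k, val l))) c + D (c a) c) ^+ 2)); last first.
  by move=> c; rewrite big_ord_recr.
rewrite (@avg_orthogonal_increment _ _ _ _ _ _ a
  (fun c => \sum_(l < j) D (c (inl (k, val l))) c) D)//.
- rewrite -natr1 mulrDl mul1r lerD ?IH ?(ltnW jr)//.
  by rewrite -[leRHS](@avg_cst _ _ _ i0 (drawn N)); exact: le_avg.
- by rewrite mem_drawn /= bk jr.
- move=> c c' cc'; apply: eq_bigr => l _.
  rewrite cc'; first exact: (Dign a).
  by apply/eqP => -[lj]; have := ltn_ord l; rewrite lj ltnn.
- by move=> i; exact: (Dign a).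
Qed.

(** The increment of the error is the centered difference of the gradients of
one random summand at two consecutive points. *)
Lemma avg_error_step k : (k.+1 <= N)%N -> ~~ (q %| k.+1)%N ->
  E (fun c => norm2 (error c k.+1) ^+ 2) <=
  E (fun c => norm2 (error c k) ^+ 2) +
  (L * h) ^+ 2 * E (fun c => norm2 (estimate c k) ^+ 2).
Proof.
move=> kN nq.
pose D i c := grad (F i) (position c k.+1) - grad (F i) (position c k).
pose d c := grad f (position c k.+1) - grad f (position c k).
have dE c : d c = m%:R^-1 *: \sum_i D i c.
  by rewrite /d !grad_mean// -scalerBr -sumrB.
pose a : label := inr k.+1.
have Dign i : ignores a (D i).
  by move=> c c' cc'; rewrite /D !(@position_ignores a _ _ _ _ cc')//=.
under [leLHS]eq_avg => c do rewrite (error_recursive _ nq).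
rewrite [leLHS](@avg_orthogonal_increment _ _ _ _ _ _ a
  (error^~ k) (fun i c => D i c - d c)).
- rewrite lerD2l -avgZ; apply: le_avg => c.
  rewrite ler_pdivrMl ?ltr0n// dE; apply: (le_trans (variance_le _ m_gt0)).
  have -> : m%:R * ((L * h) ^+ 2 * norm2 (estimate c k) ^+ 2) =
      \sum_(i < m) (L * h) ^+ 2 * norm2 (estimate c k) ^+ 2.
    by rewrite sumr_const card_ord mulr_natl.
  apply: ler_sum => i _; rewrite exprMn -mulrA -norm2_sqrZ -exprMn.
  apply: lerXn2r; rewrite ?nnegrE ?mulr_ge0 ?norm2_ge0 ?(ltW L_gt0)//.
  apply: (le_trans (F_smooth _ _ _)).
  rewrite positionS addrAC subrr add0r -scaleNr ler_pM2l//.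
  by rewrite -[leRHS]ger0_norm ?norm2_ge0// -[leLHS]ger0_norm ?norm2_ge0//
       -!sqrtr_sqr !norm2_sqrZ sqrrN.
- by rewrite mem_drawn /= kN andbT -negb_or restartE.
- move=> c c' cc'; rewrite /error (@estimate_ignores a _ _ _ _ cc')//.
  by rewrite (@position_ignores a _ _ _ _ cc')//=.
- move=> i c c' cc'; rewrite !dE (Dign i c c' cc').
  by congr (_ - _ *: _); apply: eq_bigr => j _; exact: Dign.
- move=> c; rewrite sumrB sumr_const card_ord -[d c *+ m]scaler_nat dE.
  by rewrite scalerA divff// scale1r subrr.
Qed.

Lemma stepsize_gt0 : 0 < h.
Proof.
rewrite /stepsize invr_gt0 !mulr_gt0// sqrtr_gt0 (periodE batchE) ltr0n.
exact: nperiod_gt0 batchE.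
Qed.

Lemma stepsize_sqr : (L * h) ^+ 2 * q%:R = 100^-1.
Proof.
have := nperiod_gt0 m_gt0 batchE; rewrite -(ltr0n R) => q0.
rewrite /stepsize (periodE batchE) exprMn exprVn !exprMn sqr_sqrtr ?ltW//.
by field; rewrite !gt_eqF.
Qed.

Lemma stepsize_le : L * h <= 10^-1.
Proof.
have q1 : 1 <= q%:R :> R by rewrite ler1n; exact: nperiod_gt0 batchE.
have : (L * h) ^+ 2 <= 10^-1 ^+ 2.
  apply: le_trans (_ : _ <= (L * h) ^+ 2 * q%:R) _; first by rewrite ler_peMr ?sqr_ge0.
  by rewrite stepsize_sqr; lra.
have Lh0 : 0 <= L * h by rewrite ltW// mulr_gt0// stepsize_gt0.
by rewrite ler_pXn2r// nnegrE invr_ge0.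
Qed.

Lemma descent_step c k : f (position c k.+1) + h / 2 * norm2 (grad f (position c k)) ^+ 2
    + 9 / 20 * h * norm2 (estimate c k) ^+ 2 <=
  f (position c k) + h / 2 * norm2 (error c k) ^+ 2.
Proof.
have h0 := stepsize_gt0.
have := mean_descent (position c k) (- h *: estimate c k) m_gt0 L_gt0 F_diff F_smooth.
rewrite scaleNr -positionS -scaleNr norm2_sqrZ sqrrN dotZr.
rewrite /error norm2_sqrB (dotC (estimate c k)).
have : h * (L * h) * norm2 (estimate c k) ^+ 2 <= h * 10^-1 * norm2 (estimate c k) ^+ 2.
  by rewrite ler_wpM2r ?sqr_ge0// ler_pM2l// stepsize_le.
lra.
Qed.

Lemma avg_descent M :
  E (fun c => f (position c M))
  + h / 2 * \sum_(k < M) E (fun c => norm2 (grad f (position c k)) ^+ 2)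
  + 9 / 20 * h * \sum_(k < M) E (fun c => norm2 (estimate c k) ^+ 2) <=
  f x0 + h / 2 * \sum_(k < M) E (fun c => norm2 (error c k) ^+ 2).
Proof.
elim: M => [|M IH]; first by rewrite !big_ord0 !mulr0 !addr0
  -[leRHS](@avg_cst R _ _ i0 (drawn N)).
have : E (fun c => f (position c M.+1) + h / 2 * norm2 (grad f (position c M)) ^+ 2
      + 9 / 20 * h * norm2 (estimate c M) ^+ 2) <=
    E (fun c => f (position c M) + h / 2 * norm2 (error c M) ^+ 2).
  by apply: le_avg => c; exact: descent_step.
rewrite !avgD !(@avgZ _ _ _ _ _ (h / 2)) (@avgZ _ _ _ _ _ (9 / 20 * h)).
by rewrite !big_ord_recr /=; lra.
Qed.

Lemma sum_avg_grad_le (fstar : R) : (forall x, fstar <= f x) ->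
  \sum_(k < N.+1) E (fun c => norm2 (grad f (position c k)) ^+ 2) <=
  20 * L * Num.sqrt (period m eps sigma2) * (f x0 - fstar)
  + N.+1%:R * (eps ^+ 2 / 20).
Proof.
move=> fmin; have h0 := stepsize_gt0.
have Eerr : \sum_(k < N.+1) E (fun c => norm2 (error c k) ^+ 2) <=
    N.+1%:R * (eps ^+ 2 / 20)
    + 100^-1 * \sum_(k < N.+1) E (fun c => norm2 (estimate c k) ^+ 2).
  rewrite -stepsize_sqr; apply: (@sum_restarted_le R
    (fun k => E (fun c => norm2 (error c k) ^+ 2))
    (fun k => E (fun c => norm2 (estimate c k) ^+ 2))).
  - exact: nperiod_gt0 batchE.
  - exact: sqr_ge0.
  - move=> k; rewrite -(@avg_cst R _ _ i0 (drawn N) 0).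
    by apply: le_avg => c; exact: sqr_ge0.
  - move=> k kN; rewrite -(restartE _ _ _ r) => /orP[bk|fk]; first exact: avg_error_batch.
    rewrite (@eq_avg _ _ _ _ _ _ (fun=> 0)) ?avg_cst ?divr_ge0 ?sqr_ge0// => c.
    by rewrite error_full// norm2_sqr dot0l.
  - by move=> k kN; exact: avg_error_step.
have G0 : 0 <= \sum_(k < N.+1) E (fun c => norm2 (estimate c k) ^+ 2).
  apply: sumr_ge0 => k _; rewrite -(@avg_cst R _ _ i0 (drawn N) 0).
  by apply: le_avg => c; exact: sqr_ge0.
have fN : fstar <= E (fun c => f (position c N.+1)).
  by rewrite -(@avg_cst R _ _ i0 (drawn N) fstar); apply: le_avg => c; exact: fmin.
have -> : 20 * L * Num.sqrt (period m eps sigma2) = 2 * h^-1.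
  by rewrite /stepsize invrK; ring.
rewrite -(ler_pM2l (divr_gt0 h0 (ltr0n R 2))).
have -> : h / 2 * (2 * h^-1 * (f x0 - fstar) + N.+1%:R * (eps ^+ 2 / 20)) =
    f x0 - fstar + h / 2 * (N.+1%:R * (eps ^+ 2 / 20)).
  by field; rewrite gt_eqF.
have := avg_descent N.+1.
have := ler_wpM2l (ltW h0) Eerr; have := mulr_ge0 (ltW h0) G0; lra.
Qed.

End Averages.

(** The product rule over all the drawn indices and the output time says that
their joint law is uniform. *)
Lemma joint_law d (Omega : measurableType d) (P : probability Omega R)
    (xb : nat -> nat -> Omega -> 'I_m) (xi : nat -> Omega -> 'I_m)
    N (tau : Omega -> 'I_N.+1) :
  (forall a, usedl a -> uniform_on P (outcome xb xi a)) ->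
  uniform_on P tau ->
  independent_classes P [set a | used m eps sigma2 r a] (choice_events xb xi tau) ->
  forall t (z : {ffun seq_sub (drawn N) -> 'I_m}), let D := [set w | tau w = t /\
    forall a, a \in drawn N -> outcome xb xi a w = extend i0 z a] in
  measurable D /\
  P D = (N.+1%:R^-1 * #|{ffun seq_sub (drawn N) -> 'I_m}|%:R^-1)%:E.
Proof.
move=> cunif tunif ind t z D.
pose s := None :: map Some (drawn N).
pose Ev (a : option label) := match a with
  | None => tau @^-1` [set t]
  | Some b => outcome xb xi b @^-1` [set extend i0 z b] end.
have DE : D = \bigcap_(a in [set` s]) Ev a.
  apply/seteqP; split=> [w [tw cw] [b|] //= |w Dw].
    by rewrite inE /= (mem_map Some_inj) => /cw.
  split; first by apply: (Dw None); rewrite /= inE eqxx.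
  by move=> b bN; apply: (Dw (Some b)); rewrite /= inE /= (mem_map Some_inj).
have useds a : a \in drawn N -> usedl a by rewrite mem_drawn => /andP[].
rewrite DE; split.
  apply: fin_bigcap_measurable; first exact: finite_seq.
  move=> [b|] /=; last by move=> _; exact: (tunif t).1.
  by rewrite inE /= (mem_map Some_inj) => /useds ub; exact: (cunif b ub _).1.
have us : uniq (drawn N) by exact: undup_uniq.
rewrite ind.
- rewrite big_cons (tunif t).2 big_map EFinM; congr (_ * _)%E.
  rewrite (eq_big_seq (fun=> (m%:R^-1)%:E)); last first.
    by move=> b /useds ub; exact: (cunif b ub _).2.
  rewrite prodEFin big_const_seq count_predT iter_mulr_1.
  by rewrite card_ffun card_ord card_seq_sub// natrX exprVn.
- by rewrite /= (map_inj_uniq Some_inj) us andbT; apply/mapP => -[].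
- by move=> [b|] //=; rewrite inE /= (mem_map Some_inj) => /useds.
- move=> [[[k j]|k]|] _ /=.
  + by exists [set extend i0 z (inl (k, j))].
  + by exists [set extend i0 z (inr k)].
  + by exists [set t].
Qed.

Lemma size_evaluations k xb i x x' :
  size (evaluations eps sigma2 r k xb i x x' : seq ('I_m * 'rV[R]_n)) =
  if (q %| k)%N then q else 2.
Proof.
rewrite -restartE /evaluations /nperiod.
case bk : (restart_batch m eps sigma2 r k).
  by case/andP: bk => ->; rewrite size_map size_iota.
case fk : (restart_full m eps sigma2 k) => //=.
by case/andP: fk; rewrite leNgt => /negbTE ->; rewrite size_map -cardE card_ord.
Qed.

End Iterates.

(** * Error bound and complexity *)

Theorem mainTheorem2 :
  exists C : nat,
  forall (R : realType) (n m : nat) (hm : (0 < m)%N)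
    (F : 'I_m -> 'rV[R]_n -> R)
    (Fdiff : forall i x, differentiable (F i) x)
    (L : R) (hL : 0 < L)
    (Fsmooth : forall i x y,
       norm2 (grad (F i) x - grad (F i) y) <= L * norm2 (x - y))
    (fstar : R) (hfstar : forall x, fstar <= mean F x)
    (sigma2 : \bar R) (hsigma2 : (0 <= sigma2)%E)
    (hvar : forall x, ((grad_variance F x)%:E <= sigma2)%E)
    (eps : R) (heps : 0 < eps) (x0 : 'rV[R]_n)
    (r : nat)
    (hr : (batch eps sigma2 < m%:R%:E)%E -> batch eps sigma2 = r%:R%:E)
    (d : measure_display) (Omega : measurableType d) (P : probability Omega R)
    (xb : nat -> nat -> Omega -> 'I_m) (xi : nat -> Omega -> 'I_m)
    (N : nat) (tau : Omega -> 'I_N.+1)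
    (xb_unif : forall k j, used m eps sigma2 r (Some (inl (k, j))) ->
       uniform_on P (xb k j))
    (xi_unif : forall k, used m eps sigma2 r (Some (inr k)) ->
       uniform_on P (xi k))
    (tau_unif : uniform_on P tau)
    (indep : independent_classes P [set a | used m eps sigma2 r a]
       (choice_events xb xi tau))
    (x g : nat -> Omega -> 'rV[R]_n)
    (hx0 : forall w, x 0%N w = x0)
    (hx : forall k w,
       x k.+1 w = x k w - stepsize m L eps sigma2 *: g k w)
    (hg : forall k w,
       g k w = direction F eps sigma2 r k (fun j => xb k j w) (xi k w)
                 (x k w) (x k.-1 w) (g k.-1 w)),
  let q := period m eps sigma2 in
  let Delta := mean F x0 - fstar in
  let err := ('E_P[fun w => (norm2 (grad (mean F) (x (tau w) w)) ^+ 2)%R])%E in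
  let Nformula := 4000 * L * Num.sqrt q * Delta / (13 * eps ^+ 2) in
  let cost := fun w =>
    (\sum_(k < N.+1) size (evaluations eps sigma2 r k (fun j => xb k j w)
                             (xi k w) (x k w) (x k.-1 w)))%N in
  [/\ (err <= (2000 * L * Num.sqrt q * Delta / (23 * N.+1%:R)
               + 33 * eps ^+ 2 / 46)%:E)%E,
      Nformula%:E =
        ((4000 * L * Delta / (13 * eps ^+ 2))%:E *
         mine (Num.sqrt m%:R)%:E (maxe 1 ((Num.sqrt 20 / eps)%:E * sqrte sigma2)))%E
    & N%:R = Nformula ->
      (err <= (eps ^+ 2)%:E)%E /\
      forall w,
        ((cost w)%:R%:E <=
          C%:R%:E *
          ((L * Delta / eps ^+ 2)%:E *
             mine (Num.sqrt m%:R)%:E (maxe 1 ((eps^-1)%:E * sqrte sigma2)) +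
           mine m%:R%:E (maxe 1 ((eps ^- 2)%:E * sigma2))))%E].
Proof.
(* The cost is at most 3 N + 3 q, where N <= 5 * 4000/13 and q <= 20 times the
   two rates: 5000 exceeds both 3 * 5 * 4000/13 and 60. *)
exists 5000%N => R n m hm F Fdiff L hL Fsmooth fstar hfstar sigma2 hsigma2 hvar
  eps heps x0 r hr d Omega P xb xi N tau xb_unif xi_unif tau_unif indep x g
  hx0 hx hg q Delta err Nformula cost.
have qE : q = (nperiod m eps sigma2 r)%:R by exact: periodE.
have q1 : 1 <= q by rewrite qE ler1n; exact: nperiod_gt0 hr.
have sq0 : 0 < Num.sqrt q by rewrite sqrtr_gt0 (lt_le_trans ltr01).
have e2 : 0 < eps ^+ 2 by rewrite exprn_gt0.
have D0 : 0 <= Delta by rewrite subr_ge0.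
have NformulaE : Nformula = 4000 * L * Delta / (13 * eps ^+ 2) * Num.sqrt q.
  by rewrite /Nformula; ring.
pose Phi (c : label -> 'I_m) k :=
  norm2 (grad (mean F) (position F L eps sigma2 x0 r c k)) ^+ 2.
pose S := \sum_(k < N.+1)
  avg (Ordinal hm) (drawn (m := m) eps sigma2 r N) (Phi^~ (val k)).
have errE : err = (N.+1%:R^-1 * S)%:E.
  rewrite /err; under eq_fun do rewrite (iterate_unique hx0 hx hg).
  apply: (expectation_avg (Y := fun (t : 'I_N.+1) c => Phi c (val t))).
  - apply: (joint_law hm) => // -[[k j]|k]; [exact: xb_unif|exact: xi_unif].
  - by move=> t c; exact: sqr_ge0.
  - move=> t c c' cc'; rewrite /Phi.
    rewrite (@position_local _ _ _ _ _ _ _ _ _ c c')// => a ua at_.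
    apply: cc'; rewrite mem_drawn (ua : used m eps sigma2 r (Some a)) /=.
    by apply: leq_trans (ltnW at_) _; rewrite -ltnS; exact: ltn_ord.
have S_le : S <= 20 * L * Num.sqrt q * Delta + N.+1%:R * (eps ^+ 2 / 20).
  exact: sum_avg_grad_le.
have N1 : 0 < N.+1%:R :> R by rewrite ltr0n.
have X0 : 0 <= L * Num.sqrt q * Delta / N.+1%:R.
  by rewrite divr_ge0 ?mulr_ge0// ltW.
have err_le : N.+1%:R^-1 * S <= 20 * (L * Num.sqrt q * Delta / N.+1%:R) + eps ^+ 2 / 20.
  rewrite mulrC ler_pdivrMr// mulrDl (mulrC (eps ^+ 2 / 20)).
  have -> : 20 * (L * Num.sqrt q * Delta / N.+1%:R) * N.+1%:R =
      20 * L * Num.sqrt q * Delta by field; rewrite gt_eqF.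
  exact: S_le.
split.
- rewrite errE lee_fin; apply: (le_trans err_le).
  have -> : 2000 * L * Num.sqrt q * Delta / (23 * N.+1%:R) =
    2000 / 23 * (L * Num.sqrt q * Delta / N.+1%:R) by field; rewrite gt_eqF.
  by move: X0; set X := _ / N.+1%:R; lra.
- by rewrite NformulaE EFinM (sqrt_period _ heps).
move=> NE; split=> [|w].
  rewrite errE lee_fin; apply: (le_trans err_le).
  have : L * Num.sqrt q * Delta / N.+1%:R <= 13 / 4000 * eps ^+ 2.
    rewrite ler_pdivrMr//.
    have -> : L * Num.sqrt q * Delta = 13 / 4000 * eps ^+ 2 * N%:R.
      by rewrite NE NformulaE; field; rewrite gt_eqF.
    have := ler_wpM2l (ltW e2) (_ : N%:R <= N.+1%:R); rewrite ler_nat leqnSn.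
    by move=> /(_ isT); lra.
  by set X := _ / N.+1%:R; lra.
have [a [b [-> -> sqa qb]]] := period_le_rates heps hsigma2 hr.
have cost_le : (cost w)%:R <= 3 * N%:R + 3 * q.
  rewrite qE -!natrM -natrD ler_nat; apply: leq_trans (sum_period_cost N _);
    last exact: nperiod_gt0 hr.
  by apply: leq_sum => k _; rewrite size_evaluations.
rewrite -!(EFinM, EFinD) lee_fin; apply: (le_trans cost_le).
have LD : 0 <= L * Delta / eps ^+ 2 by rewrite divr_ge0 ?mulr_ge0// ltW.
have := ler_wpM2l LD sqa.
have -> : N%:R = 4000 / 13 * (L * Delta / eps ^+ 2 * Num.sqrt q).
  by rewrite NE NformulaE; field; rewrite gt_eqF.
have b0 : 0 <= b by rewrite /q in q1; lra.
have a0 : 0 <= L * Delta / eps ^+ 2 * a by rewrite mulr_ge0//; rewrite /q in sq0; lra.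
rewrite /q in qb *; lra.
Qed.
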